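(* For $a,b,c,d,e,f\in\mathbb{C}$ let $T_{8C}(a,b,c,d,e,f)$ be the $8\times 8$ matrix $$ \begin{bmatrix} a & b d & d & a b & a d & b c & a c & b d \\ b d & -a & a b & -d & b c & -a d & b d & -a c \\ d & a b & b d e f & -a e f & a c f & b d f & b c e & -a d e \\ a b & -d & -a e f & -b d e f & b d f & -a c f & -a d e & -b c e \\ a c & b d & a d f & b c f & -c d f & -a b c f & -a c & -b c d \\ b d & -a c & b c f & -a d f & -a b c f & c d f & -b c d & a c \\ a d & b c & b d e & -a c e & -a c & -b c d & -a b c e & c d e \\ b c & -a d & -a c e & -b d e & -b c d & a c & c d e & a b c e \end{bmatrix}. $$ For $a,b,c\in\mathbb{T}$ define \begin{align*} A_1&=-a^2 +a^2 b^2 -a^2 c+b^2 c,\qquad A_2=a^2+a^4-4 a^2 b^2+b^4+a^2 b^4,\\ A_3&=-a^4 b^2-a^4 c+a^2 b^2 c+a^4 b^2 c-a^2 b^4 c-a^2 c^2-a^4 c^2+6 a^2 b^2 c^2-b^4 c^2-a^2 b^4 c^2\\&\quad-a^2 c^3+b^2 c^3+a^2 b^2 c^3-b^4 c^3-b^2 c^4,\\ B_1&=a^2-b^2+c-b^2 c,\qquad B_2=-2 a (a-b) (b-1) (1+b) (a+b) A_3,\qquad B_3=2 bc (a-c)(a+c)A_1A_2,\\ C&=(1+c)^2 (a^2+c)^2 (c-b^2)^2 (a^2-b^2 c)^2A_2^2 -4 a^2 (a^2-b^2)^2 (b^2-1)^2 A_3^2, \end{align*} and \begin{align*} d'&=-\sqrt{c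 A_1}/\sqrt{B_1},\\ e'&=d' \big((1 - a) (1 + a) (a - b^2) (a + b^2) A_3 + \sqrt{C}\big)/B_3,\\ f'&=\big((c-b^2) (c+1) (a^2+c) (a^2-b^2 c)A_2+\sqrt{C}\big)/B_2 . \end{align*} Let $D=\{(a,b,c)\in\mathbb{T}^3 : C/(a^8b^8c^4)\text{ is a real number }\le 0,\ B_1\neq 0,\ B_2\neq 0,\ B_3\neq 0\}$ and $\mathcal{S}_C(a,b,c)=T_{8C}(a,b,c,d',e',f')$. Then $T^{(3)}_{8C}:=\mathcal{S}_C(D)$ is a $3$-parameter family of complex Hadamard matrices.
   Context: $\mathbb{T}=\{z\in\mathbb{C}:|z|=1\}$. A matrix $H\in M_n(\mathbb{T})$ is a complex Hadamard matrix of order $n$ if $HH^\dagger=nI$; the set of these is $\mathbb{H}(n)$. A $k$-parameter family of complex Hadamard matrices is a set $f(D)$ where $D\subseteq\mathbb{T}^k$ (parametrized by real angles $x_j=e^{i\theta_j}$, so $D$ is regarded as a subset of $\mathbb{R}^k$) and $f:D\to\mathbb{H}(n)$ is continuous, such that $k$ equals the rank of the Jacobian matrix of $f$ (viewed as a map from real parameters into $\mathbb{C}^{n\times n}\cong\mathbb{R}^{2n^2}$) at some point in the interior of $D$. Here $\sqrt{\cdot}$ denotes the principal branch of the complex square root, and the same value of $\sqrt{C}$ is used in $e'$ and $f'$. *)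

(* Defs.v *)
From HB Require Import structures.
From mathcomp Require Import all_boot all_order all_algebra.
From mathcomp Require Import complex.
From mathcomp Require Import all_classical all_reals all_analysis.

Set Implicit Arguments.
Unset Strict Implicit.
Unset Printing Implicit Defensive.

Import Order.TTheory GRing.Theory Num.Theory.
Import numFieldNormedType.Exports.

Local Open Scope classical_set_scope.
Local Open Scope ring_scope.
Local Open Scope complex_scope.
Local Open Scope sesquilinear_scope.

(* The topology of R[i] is the one of its modulus, seen as a norm over itself. *)
HB.instance Definition _ (R : realType) := NormedModule.copy R[i] R[i]^o.

Section ParametricFamilies.
Variable R : realType.

Definition torus k : set 'rV[R[i]]_k :=
  [set x : 'rV[R[i]]_k | forall j, `|x 0 j| = 1].

Definition hadamard n : set 'M[R[i]]_n :=
  [set H : 'M[R[i]]_n | (forall i j, `|H i j| = 1) /\ H *m H ^t* = n%:R%:M].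

Definition expi (t : R) : R[i] := cos t +i* sin t.

Definition torus_of_angles k (theta : 'rV[R]_k) : 'rV[R[i]]_k :=
  map_mx expi theta.

Definition realify n (M : 'M[R[i]]_n) : 'rV[R]_(n * n + n * n) :=
  row_mx (mxvec (map_mx (@complex.Re R) M)) (mxvec (map_mx (@complex.Im R) M)).

Definition in_angles k n (f : 'rV[R[i]]_k -> 'M[R[i]]_n) (theta : 'rV[R]_k) :=
  realify (f (torus_of_angles theta)).

(* Being a k-parameter family is a property of the set of matrices: some pair
   (D, f) has to parametrize it. A given formula for its elements need not be
   such an f; formulas written with principal square roots jump where a radicand
   crosses the negative real axis. *)
Definition parametric_family k n (S : set 'M[R[i]]_n) : Prop :=
  exists (D : set 'rV[R[i]]_k)
      (f : 'rV[R[i]]_k -> 'M[R[i]]_n),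
    [/\ D `<=` @torus k,
        f @` D `<=` @hadamard n,
        {within D, continuous f},
        (exists theta : 'rV[R]_k,
           [/\ (@torus_of_angles k @^-1` D)° theta,
               differentiable (in_angles f) theta &
               \rank ('J (in_angles f) theta) = k]) &
        S = f @` D].

End ParametricFamilies.

Section T8C.
Variable R : realType.
Implicit Types a b c d e f : R[i].

Definition T8C a b c d e f : 'M[R[i]]_8 :=
  \matrix_(i < 8, j < 8) nth 0 (nth [::]
   [:: [:: a; b * d; d; a * b; a * d; b * c; a * c; b * d];
       [:: b * d; - a; a * b; - d; b * c; - (a * d); b * d; - (a * c)];
       [:: d; a * b; b * d * e * f; - (a * e * f);
           a * c * f; b * d * f; b * c * e; - (a * d * e)];
       [:: a * b; - d; - (a * e * f); - (b * d * e * f);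
           b * d * f; - (a * c * f); - (a * d * e); - (b * c * e)];
       [:: a * c; b * d; a * d * f; b * c * f;
           - (c * d * f); - (a * b * c * f); - (a * c); - (b * c * d)];
       [:: b * d; - (a * c); b * c * f; - (a * d * f);
           - (a * b * c * f); c * d * f; - (b * c * d); a * c];
       [:: a * d; b * c; b * d * e; - (a * c * e);
           - (a * c); - (b * c * d); - (a * b * c * e); c * d * e];
       [:: b * c; - (a * d); - (a * c * e); - (b * d * e);
           - (b * c * d); a * c; c * d * e; a * b * c * e]] i) j.

Definition A1 a b c := - a ^+ 2 + a ^+ 2 * b ^+ 2 - a ^+ 2 * c + b ^+ 2 * c.

Definition A2 a b :=
  a ^+ 2 + a ^+ 4 - 4 * a ^+ 2 * b ^+ 2 + b ^+ 4 + a ^+ 2 * b ^+ 4.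

Definition A3 a b c :=
  - (a ^+ 4 * b ^+ 2) - a ^+ 4 * c + a ^+ 2 * b ^+ 2 * c + a ^+ 4 * b ^+ 2 * c
  - a ^+ 2 * b ^+ 4 * c - a ^+ 2 * c ^+ 2 - a ^+ 4 * c ^+ 2
  + 6 * a ^+ 2 * b ^+ 2 * c ^+ 2 - b ^+ 4 * c ^+ 2 - a ^+ 2 * b ^+ 4 * c ^+ 2
  - a ^+ 2 * c ^+ 3 + b ^+ 2 * c ^+ 3 + a ^+ 2 * b ^+ 2 * c ^+ 3
  - b ^+ 4 * c ^+ 3 - b ^+ 2 * c ^+ 4.

Definition B1 a b c := a ^+ 2 - b ^+ 2 + c - b ^+ 2 * c.

Definition B2 a b c :=
  - 2 * a * (a - b) * (b - 1) * (1 + b) * (a + b) * A3 a b c.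

Definition B3 a b c := 2 * b * c * (a - c) * (a + c) * A1 a b c * A2 a b.

Definition C a b c :=
  (1 + c) ^+ 2 * (a ^+ 2 + c) ^+ 2 * (c - b ^+ 2) ^+ 2
    * (a ^+ 2 - b ^+ 2 * c) ^+ 2 * A2 a b ^+ 2
  - 4 * a ^+ 2 * (a ^+ 2 - b ^+ 2) ^+ 2 * (b ^+ 2 - 1) ^+ 2 * A3 a b c ^+ 2.

(* sqrtc is the principal branch: its values have argument in ]-pi/2, pi/2]. *)
Definition d' a b c := - sqrtc (c * A1 a b c) / sqrtc (B1 a b c).

Definition e' a b c :=
  d' a b c * ((1 - a) * (1 + a) * (a - b ^+ 2) * (a + b ^+ 2) * A3 a b c
              + sqrtc (C a b c)) / B3 a b c.

Definition f' a b c :=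
  ((c - b ^+ 2) * (c + 1) * (a ^+ 2 + c) * (a ^+ 2 - b ^+ 2 * c) * A2 a b
   + sqrtc (C a b c)) / B2 a b c.

(* In the order of R[i], z <= 0 says that z is a real number and z <= 0. *)
Definition domain_C : set (R[i] * R[i] * R[i]) :=
  [set x | let: (a, b, c) := x in
    [/\ `|a| = 1, `|b| = 1 & `|c| = 1] /\
    [/\ C a b c / (a ^+ 8 * b ^+ 8 * c ^+ 4) <= 0,
        B1 a b c != 0, B2 a b c != 0 & B3 a b c != 0]].

Definition S_C (x : R[i] * R[i] * R[i]) : 'M[R[i]]_8 :=
  let: (a, b, c) := x in T8C a b c (d' a b c) (e' a b c) (f' a b c).

End T8C.

(* Main.v *)
Require Import Defs.
From HB Require Import structures.
From mathcomp Require Import all_boot all_order all_algebra.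
From mathcomp Require Import complex ring lra.
From mathcomp Require Import all_classical all_reals all_analysis.

Set Implicit Arguments.
Unset Strict Implicit.
Unset Printing Implicit Defensive.

Import Order.TTheory GRing.Theory Num.Theory.
Import numFieldNormedType.Exports.

Local Open Scope classical_set_scope.
Local Open Scope ring_scope.
Local Open Scope complex_scope.
Local Open Scope sesquilinear_scope.

(** Put [P = a^2 - b^2], [Q = a (1 - b^2)], [U = c A1 B1], [V = b^2 (a^2 - c^2)^2],
    and let [Y], [X] be the polynomial parts of the numerators of [f'], [e'/d'].
    Everything rests on the factorizations

      [X = (Q^2 - P^2) A3],  [Y = - (U + V) A2],  [(P^2 + Q^2) A3 = (U - V) A2],
      [B2 = 2 P Q A3],  [C = Y^2 - B2^2].

    Two distinct rows of [T8C] are orthogonal up to one of three relations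
    between the parameters; they follow from [d'^2 B1 = c A1], the definition
    of [e'], [f'], and [(sqrt C)^2 = C].  On the torus [a^4 b^4 c^2] normalizes
    [X], [Y], [B2] to real numbers, so [C / (a^8 b^8 c^4) <= 0] makes the
    normalized [sqrt C] purely imaginary, and [|e'| = |f'| = 1] become
    [X^2 - C = - 4 U V A2^2] and [Y^2 - C = B2^2].

    The formulas for [d'] and [sqrt C] are discontinuous, but only by a sign:
    [d' = +- A1 / (|A1| a b)] and [sqrt C = +- i a^4 b^4 c^2 sqrt |C|].  The
    family is therefore parametrized by points [(x0, x1, x2)] of the torus with
    [a = x0^4], [b = x1^4], [c = x2], the two signs being those of [Re x0] and
    [Re x1], restricted to the points at which these signs are the correct ones.
    Every unit number has a fourth root with real part of prescribed sign, so
    the whole set of matrices is reached.  The rank of the Jacobian is read off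
    the entries [a], [a b] and [a c]. *)

(** * Polynomial identities between the coefficients *)

Section Identities.
Variable R : realType.
Implicit Types a b c : R[i].

Definition Pab a b := a ^+ 2 - b ^+ 2.
Definition Qab a b := a * (1 - b ^+ 2).
Definition Uabc a b c := c * A1 a b c * B1 a b c.
Definition Vabc a b c := b ^+ 2 * (a ^+ 2 - c ^+ 2) ^+ 2.
Definition num_e a b c :=
  (1 - a) * (1 + a) * (a - b ^+ 2) * (a + b ^+ 2) * A3 a b c.
Definition num_f a b c :=
  (c - b ^+ 2) * (c + 1) * (a ^+ 2 + c) * (a ^+ 2 - b ^+ 2 * c) * A2 a b.

Lemma num_fE a b c : num_f a b c = - (Uabc a b c + Vabc a b c) * A2 a b.
Proof. by rewrite /num_f /Uabc /Vabc /A1 /B1; ring. Qed.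

Lemma sqrPQ_A3E a b c :
  (Pab a b ^+ 2 + Qab a b ^+ 2) * A3 a b c = (Uabc a b c - Vabc a b c) * A2 a b.
Proof. by rewrite /Pab /Qab /Uabc /Vabc /A1 /A2 /A3 /B1; ring. Qed.

Lemma num_eE a b c : num_e a b c = (Qab a b ^+ 2 - Pab a b ^+ 2) * A3 a b c.
Proof. by rewrite /num_e /Pab /Qab; ring. Qed.

Lemma B2E a b c : B2 a b c = 2 * Pab a b * Qab a b * A3 a b c.
Proof. by rewrite /B2 /Pab /Qab; ring. Qed.

Lemma CE_sqr a b c : C a b c = num_f a b c ^+ 2 - B2 a b c ^+ 2.
Proof. by rewrite /C /B2 /num_f; ring. Qed.

End Identities.

(** * Orthogonality of the rows of [T8C] *)

Section Gram.
Variable R : realType.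
Implicit Types a b c d e f z : R[i].

Lemma conj_unit z : `|z| = 1 -> (z^*)%R = z^-1.
Proof. by move=> z1; rewrite invC_norm z1 expr1n invr1 mul1r. Qed.

Lemma unit_neq0 z : `|z| = 1 -> z != 0.
Proof. by move=> z1; rewrite -normr_eq0 z1 oner_eq0. Qed.

(* Up to units, the inner products of distinct rows of [T8C] are [0] or one
   of the three following expressions. *)
Definition gram1 a b c d := d ^+ 2 * B1 a b c - c * A1 a b c.
Definition gram2 a b c d e f :=
  b * c * (d ^+ 2 + a ^+ 2) * e * f + c * (a ^+ 2 - b ^+ 2) * d * f
  + a * b * (d ^+ 2 + c ^+ 2) * e + a * c * (1 - b ^+ 2) * d.
Definition gram3 a b c d e f :=
  b * c * (d ^+ 2 + a ^+ 2) - c * (a ^+ 2 - b ^+ 2) * d * e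
  - a * c * (1 - b ^+ 2) * d * e * f + a * b * (d ^+ 2 + c ^+ 2) * f.

Lemma T8C_hadamard a b c d e f :
  `|a| = 1 -> `|b| = 1 -> `|c| = 1 -> `|d| = 1 -> `|e| = 1 -> `|f| = 1 ->
  gram1 a b c d = 0 -> gram2 a b c d e f = 0 -> gram3 a b c d e f = 0 ->
  @hadamard R 8 (T8C a b c d e f).
Proof.
move=> a1 b1 c1 d1 e1 f1 G1 G2 G3.
have [a0 b0 c0] := And3 (unit_neq0 a1) (unit_neq0 b1) (unit_neq0 c1).
have [d0 e0 f0] := And3 (unit_neq0 d1) (unit_neq0 e1) (unit_neq0 f1).
have nE i j : `|T8C a b c d e f i j| = 1.
  rewrite mxE; case: i => [[|[|[|[|[|[|[|[|//]]]]]]]] hi];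
  case: j => [[|[|[|[|[|[|[|[|//]]]]]]]] hj] /=;
  by rewrite ?normrN ?normrM ?a1 ?b1 ?c1 ?d1 ?e1 ?f1 ?mulr1.
split=> //.
have G (i j : 'I_8) : (i < j)%N ->
    (T8C a b c d e f *m (T8C a b c d e f) ^t*) i j = 0.
  (* On the torus conjugation is inversion, so an inner product of rows is a Laurent polynomial in
     the parameters. If not identically zero, it is, up to sign, one of the five quotients prepared
     here. *)
  have {}G1 : (a * b * c * d)^-1 * gram1 a b c d = 0 by rewrite G1 mulr0.
  have G2' : (a * b * c * d * e)^-1 * gram2 a b c d e f = 0 by rewrite G2 mulr0.
  have {}G2 : (a * b * c * d * e * f)^-1 * gram2 a b c d e f = 0 by rewrite G2 mulr0.
  have G3' : (a * b * c * d * e)^-1 * gram3 a b c d e f = 0 by rewrite G3 mulr0.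
  have {}G3 : (a * b * c * d * e * f)^-1 * gram3 a b c d e f = 0 by rewrite G3 mulr0.
  rewrite mxE !big_ord_recl big_ord0 addr0 !mxE.
  case: i => [[|[|[|[|[|[|[|[|//]]]]]]]] hi];
  case: j => [[|[|[|[|[|[|[|[|//]]]]]]]] hj] //= _;
  rewrite ?(rmorphN, rmorphM) /= ?(conj_unit a1, conj_unit b1, conj_unit c1);
  rewrite ?(conj_unit d1, conj_unit e1, conj_unit f1);
  first [ by field; rewrite ?a0 ?b0 ?c0 ?d0 ?e0 ?f0
        | by rewrite -[RHS]G1 /gram1 /A1 /B1; field; rewrite ?a0 ?b0 ?c0 ?d0 ?e0 ?f0
        | by rewrite -[RHS]G2 /gram2; field; rewrite ?a0 ?b0 ?c0 ?d0 ?e0 ?f0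
        | by rewrite -[RHS]G2' /gram2; field; rewrite ?a0 ?b0 ?c0 ?d0 ?e0 ?f0
        | by rewrite -[RHS]G3 /gram3; field; rewrite ?a0 ?b0 ?c0 ?d0 ?e0 ?f0
        | by rewrite -[RHS]G3' /gram3; field; rewrite ?a0 ?b0 ?c0 ?d0 ?e0 ?f0
        | by apply/eqP; rewrite -oppr_eq0; apply/eqP; rewrite -[RHS]G3 /gram3;
          field; rewrite ?a0 ?b0 ?c0 ?d0 ?e0 ?f0
        | by apply/eqP; rewrite -oppr_eq0; apply/eqP; rewrite -[RHS]G3' /gram3;
          field; rewrite ?a0 ?b0 ?c0 ?d0 ?e0 ?f0 ].
apply/matrixP => i j; rewrite [RHS]mxE; have [ij|ji|ij] := ltngtP i j.
- by rewrite -val_eqE /= (ltn_eqF ij) mulr0n G.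
- rewrite -val_eqE /= (gtn_eqF ji) mulr0n.
  have /(congr1 (fun z => (z^*)%R)) := G j i ji; rewrite /= rmorph0 => <-.
  rewrite mxE [in RHS]mxE rmorph_sum; apply: eq_bigr => k _ /=.
  by rewrite ![(_ ^t*) _ _]mxE rmorphM /= conjCK mulrC !mxE.
- rewrite -(val_inj ij) eqxx mulr1n mxE (eq_bigr (fun=> 1)) => [|k _].
    by rewrite sumr_const card_ord.
  by rewrite [X in _ * X]mxE [X in _ * (X^*)%R]mxE -normCK nE expr1n.
Qed.

End Gram.

(** * The Gram relations for the prescribed [d'], [e'], [f'] *)

Section Relations.
Variable R : realType.
Implicit Types a b c d e f z s : R[i].

Lemma B2_neq0E a b c : B2 a b c != 0 ->
  [/\ Pab a b != 0, Qab a b != 0 & A3 a b c != 0].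
Proof. by rewrite B2E !mulf_eq0 !negb_or => /andP[/andP[/andP[_ ->] ->] ->]. Qed.

Lemma B3_neq0E a b c : B3 a b c != 0 ->
  [/\ a ^+ 2 - c ^+ 2 != 0, A1 a b c != 0 & A2 a b != 0].
Proof.
rewrite /B3 !mulf_eq0 !negb_or.
move=> /andP[/andP[/andP[/andP[_ amc] apc] ->] ->]; split=> //.
by rewrite subr_sqr mulf_neq0.
Qed.

(** The sums [d ^+ 2 + a ^+ 2] and [d ^+ 2 + c ^+ 2] occur in [gram2] and [gram3]. After
    multiplication by [B1] they factor, with the common factor [a ^+ 2 - c ^+ 2]. *)
Lemma sqrD_B1 a b c d : d ^+ 2 * B1 a b c = c * A1 a b c ->
  (d ^+ 2 + a ^+ 2) * B1 a b c = Pab a b * (a ^+ 2 - c ^+ 2) /\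
  a * (d ^+ 2 + c ^+ 2) * B1 a b c = - c * Qab a b * (a ^+ 2 - c ^+ 2).
Proof.
move=> dB; split; [rewrite mulrDl|rewrite -mulrA mulrDl]; rewrite dB.
  by rewrite /A1 /B1 /Pab; ring.
by rewrite /A1 /B1 /Qab; ring.
Qed.

(** Subtracting the factorization of [num_f] from that of [(P^2 + Q^2) A3] isolates [U A2]; changing
    the sign of the latter first isolates [V A2]. *)
Lemma double_U a b c :
  2 * Uabc a b c * A2 a b = (Pab a b ^+ 2 + Qab a b ^+ 2) * A3 a b c - num_f a b c.
Proof. by rewrite sqrPQ_A3E num_fE; ring. Qed.

Lemma double_V a b c :
  2 * Vabc a b c * A2 a b = - (Pab a b ^+ 2 + Qab a b ^+ 2) * A3 a b c - num_f a b c.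
Proof. by rewrite mulNr sqrPQ_A3E num_fE; ring. Qed.

Section Fixed.
Variables a b c d s : R[i].
Hypotheses (dB : d ^+ 2 * B1 a b c = c * A1 a b c) (sC : s ^+ 2 = C a b c).
Hypotheses (b0 : b != 0) (c0 : c != 0).
Hypotheses (B10 : B1 a b c != 0) (B20 : B2 a b c != 0) (B30 : B3 a b c != 0).
Let e := d * (num_e a b c + s) / B3 a b c.
Let f := (num_f a b c + s) / B2 a b c.

Let eE : 2 * b * c * (a ^+ 2 - c ^+ 2) * A1 a b c * A2 a b * e = d * (num_e a b c + s).
Proof. by rewrite /e mulrC -[RHS](divfK B30) /B3; ring. Qed.

Let fE : 2 * Pab a b * Qab a b * A3 a b c * f = num_f a b c + s.
Proof. by rewrite /f mulrC B2E divfK // -B2E. Qed.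

Let sE :
  s ^+ 2 = num_f a b c ^+ 2 - 4 * Pab a b ^+ 2 * Qab a b ^+ 2 * A3 a b c ^+ 2.
Proof. by rewrite sC CE_sqr B2E; ring. Qed.

Let nz2 : (2 : R[i]) != 0. Proof. by rewrite pnatr_eq0. Qed.

Lemma gram2_eq0 : gram2 a b c d e f = 0.
Proof.
have [P0 Q0 A30] := B2_neq0E B20; have [ac0 A10 A20] := B3_neq0E B30.
have [dP dQ] := sqrD_B1 dB; have [eM fPQ sPQ] := And3 eE fE sE.
set M := a ^+ 2 - c ^+ 2 in ac0 dP dQ eM.
set P := Pab a b in P0 dP fPQ sPQ; set Q := Qab a b in Q0 dQ fPQ sPQ.
have gram2E : gram2 a b c d e f * B1 a b c =
    c * (b * M * e * (P * f - Q) + d * B1 a b c * (P * f + Q)).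
  transitivity (b * c * ((d ^+ 2 + a ^+ 2) * B1 a b c) * e * f
    + c * P * d * f * B1 a b c + b * (a * (d ^+ 2 + c ^+ 2) * B1 a b c) * e
    + c * Q * d * B1 a b c); first by rewrite /gram2 /P /Q /Pab /Qab; ring.
  by rewrite dP dQ; ring.
(* [B1] makes [gram2E] applicable. The other factors complete the coefficients of [e] and [f] to the
   left-hand sides of [eE] and [fE], and turn [B1] into [U]. *)
have k0 : 2 * A1 a b c * A2 a b * (2 * Q * A3 a b c) * B1 a b c != 0.
  by do ![exact: nz2 | by [] | apply: mulf_neq0].
apply: (mulfI k0); rewrite mulr0 -[LHS]mulrA [B1 a b c * _]mulrC gram2E.
transitivity (2 * b * c * M * A1 a b c * A2 a b * e
      * (2 * P * Q * A3 a b c * f - 2 * Q ^+ 2 * A3 a b c)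
    + d * (2 * Uabc a b c * A2 a b) * (2 * P * Q * A3 a b c * f + 2 * Q ^+ 2 * A3 a b c)).
  by rewrite /Uabc; ring.
rewrite eM fPQ double_U num_eE -/P -/Q.
(* The terms linear in [s] cancel, and what is left is [d (s^2 - C)]. *)
transitivity (d * (s ^+ 2 - (num_f a b c ^+ 2 - 4 * P ^+ 2 * Q ^+ 2 * A3 a b c ^+ 2))).
  by ring.
by rewrite sPQ subrr mulr0.
Qed.

Lemma gram3_eq0 : gram3 a b c d e f = 0.
Proof.
have [P0 Q0 A30] := B2_neq0E B20; have [ac0 A10 A20] := B3_neq0E B30.
have [dP dQ] := sqrD_B1 dB; have [eM fPQ sPQ] := And3 eE fE sE.
set M := a ^+ 2 - c ^+ 2 in ac0 dP dQ eM.
set P := Pab a b in P0 dP fPQ sPQ; set Q := Qab a b in Q0 dQ fPQ sPQ.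
have gram3E : gram3 a b c d e f * B1 a b c =
    c * (b * M * (P - Q * f) - B1 a b c * d * e * (P + Q * f)).
  transitivity (b * c * ((d ^+ 2 + a ^+ 2) * B1 a b c)
    - c * P * d * e * B1 a b c - c * Q * d * e * f * B1 a b c
    + b * (a * (d ^+ 2 + c ^+ 2) * B1 a b c) * f).
    by rewrite /gram3 /P /Q /Pab /Qab; ring.
  by rewrite dP dQ; ring.
(* The additional factor [b M] produces [V = b^2 M^2] in the terms free of [e]. In the others [e]
   brings a second [d], and [d^2 B1 = c A1] then gives both groups the factor [c A1]. *)
have k0 : 2 * b * M * A1 a b c * A2 a b * (2 * P * A3 a b c) * B1 a b c != 0.
  by do ![exact: nz2 | by [] | apply: mulf_neq0].
apply: (mulfI k0); rewrite mulr0 -[LHS]mulrA [B1 a b c * _]mulrC gram3E.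
transitivity (c * A1 a b c * (2 * Vabc a b c * A2 a b)
      * (2 * P ^+ 2 * A3 a b c - 2 * P * Q * A3 a b c * f)
    - (2 * b * c * M * A1 a b c * A2 a b * e) * d * B1 a b c
      * (2 * P ^+ 2 * A3 a b c + 2 * P * Q * A3 a b c * f)).
  by rewrite /Vabc -/M; ring.
rewrite eM fPQ double_V num_eE -/P -/Q.
transitivity (c * A1 a b c * (- (P ^+ 2 + Q ^+ 2) * A3 a b c - num_f a b c)
      * (2 * P ^+ 2 * A3 a b c - (num_f a b c + s))
    - d ^+ 2 * B1 a b c * ((Q ^+ 2 - P ^+ 2) * A3 a b c + s)
      * (2 * P ^+ 2 * A3 a b c + (num_f a b c + s))); first by ring.
rewrite dB.
transitivity (c * A1 a b c *
    (num_f a b c ^+ 2 - 4 * P ^+ 2 * Q ^+ 2 * A3 a b c ^+ 2 - s ^+ 2)).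
  by ring.
by rewrite sPQ subrr mulr0.
Qed.
End Fixed.
End Relations.

(** * Conjugation on the torus and the moduli of [d'], [e'], [f'] *)

Section Moduli.
Variable R : realType.
Implicit Types a b c d e f z s : R[i].

(** Such a [z] is purely imaginary: its product with its conjugate is [|z^2| = - z^2], and [z]
    cancels. *)
Lemma conj_sqr_le0 z : z ^+ 2 <= 0 -> (z^*)%R = - z.
Proof.
move=> z2; have [->|z0] := eqVneq z 0; first by rewrite rmorph0 oppr0.
apply: (mulfI z0); rewrite -normCK mulrN -expr2.
by rewrite -normrX ler0_norm.
Qed.

Lemma norm_conj_mul z : z * (z^*)%R = 1 -> `|z| = 1.
Proof. by rewrite -normCK => /eqP; rewrite sqrp_eq1 // => /eqP. Qed.

Section Torus.
Variables a b c : R[i].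
Hypotheses (a1 : `|a| = 1) (b1 : `|b| = 1) (c1 : `|c| = 1).

Let a0 := unit_neq0 a1.
Let b0 := unit_neq0 b1.
Let c0 := unit_neq0 c1.

Definition cnorm := a ^+ 4 * b ^+ 4 * c ^+ 2.

Lemma cnorm_unit : `|cnorm| = 1.
Proof. by rewrite /cnorm !normrM ?a1 ?b1 ?c1 !mulr1. Qed.

Ltac conj_tac := rewrite ?(rmorphB, rmorphD, rmorphN, rmorphM, rmorphXn, rmorph1) /=;
  rewrite ?(rmorph_nat, rmorph1) ?(conj_unit a1) ?(conj_unit b1) ?(conj_unit c1); field;
  rewrite ?a0 ?b0 ?c0.

(** Conjugation inverts the variables, hence sends a polynomial to its reciprocal up to a monomial.
    [A1] and [B1] are exchanged, whence [|d'| = 1], while [A2] and [A3] are self-reciprocal. *)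
Lemma conj_A1 : ((A1 a b c)^*)%R = B1 a b c / (a ^+ 2 * b ^+ 2 * c).
Proof. by rewrite /A1 /B1; conj_tac. Qed.

Lemma conj_A2 : ((A2 a b)^*)%R = A2 a b / (a ^+ 4 * b ^+ 4).
Proof. by rewrite /A2; conj_tac. Qed.

Lemma conj_A3 : ((A3 a b c)^*)%R = A3 a b c / (a ^+ 4 * b ^+ 4 * c ^+ 4).
Proof. by rewrite /A3; conj_tac. Qed.

(** Since [cnorm] is a unit number, a relation of this form says that the quotient by [cnorm] is
    real. *)
Lemma conj_num_e : ((num_e a b c)^*)%R = num_e a b c / cnorm ^+ 2.
Proof. by rewrite /num_e rmorphM /= conj_A3 /cnorm; conj_tac. Qed.

Lemma conj_num_f : ((num_f a b c)^*)%R = num_f a b c / cnorm ^+ 2.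
Proof. by rewrite /num_f rmorphM /= conj_A2 /cnorm; conj_tac. Qed.

Lemma conj_B2 : ((B2 a b c)^*)%R = B2 a b c / cnorm ^+ 2.
Proof. by rewrite /B2 rmorphM /= conj_A3 /cnorm; conj_tac. Qed.

(** The reality required in [domain_C] thus holds on the whole torus and only the sign is a
    constraint, an open one where it is strict. *)
Lemma conj_C : ((C a b c / cnorm ^+ 2)^*)%R = C a b c / cnorm ^+ 2.
Proof.
have N0 := unit_neq0 cnorm_unit.
rewrite CE_sqr rmorphM fmorphV rmorphB !rmorphXn /= conj_num_f conj_B2.
by rewrite (conj_unit cnorm_unit); field.
Qed.

Lemma norm_A1 : `|A1 a b c| = `|B1 a b c|.
Proof.
rewrite -[LHS]norm_conjC conj_A1 normrM normfV !normrM a1 b1 c1.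
by rewrite !mulr1 invr1 mulr1.
Qed.

Variables d s : R[i].
Hypotheses (dB : d ^+ 2 * B1 a b c = c * A1 a b c) (sC : s ^+ 2 = C a b c).
Hypotheses (C0 : C a b c / (a ^+ 8 * b ^+ 8 * c ^+ 4) <= 0).
Hypotheses (B10 : B1 a b c != 0) (B20 : B2 a b c != 0) (B30 : B3 a b c != 0).

Lemma norm_d : `|d| = 1.
Proof.
have : `|d| ^+ 2 * `|B1 a b c| = `|B1 a b c|.
  by rewrite -normrX -normrM dB normrM c1 mul1r norm_A1.
rewrite -[RHS]mul1r => /(mulIf _); rewrite normr_eq0 => /(_ B10)/eqP.
by rewrite sqrp_eq1 // => /eqP.
Qed.

Lemma conj_s : (s^*)%R = - s / cnorm ^+ 2.
Proof.
have N0 := unit_neq0 cnorm_unit.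
have /conj_sqr_le0 : (s / cnorm) ^+ 2 <= 0.
  by rewrite expr_div_n sC; congr (_ <= 0): C0; congr (_ / _); rewrite /cnorm; ring.
rewrite rmorphM fmorphV /= (conj_unit cnorm_unit) invrK => /(congr1 ( *%R^~ cnorm^-1)).
by rewrite mulfK // => ->; field.
Qed.

Lemma norm_f : `|(num_f a b c + s) / B2 a b c| = 1.
Proof.
have N0 := unit_neq0 cnorm_unit.
apply: norm_conj_mul; rewrite rmorphM rmorphD fmorphV /= conj_num_f conj_B2 conj_s.
(* Up to the normalization, conjugation changes only the sign of [s], so the numerator is a
   difference of squares. *)
transitivity ((num_f a b c ^+ 2 - s ^+ 2) / B2 a b c ^+ 2).
  by field; rewrite B20 N0.
by rewrite sC CE_sqr opprB addrC subrK divff // expf_neq0.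
Qed.

Lemma norm_e : `|d * (num_e a b c + s) / B3 a b c| = 1.
Proof.
have N0 := unit_neq0 cnorm_unit; have [M0 A10 A20] := B3_neq0E B30.
have /andP[Mm Mp] : (a - c != 0) && (a + c != 0).
  by rewrite -negb_or -mulf_eq0 -subr_sqr.
rewrite -mulrA normrM norm_d mul1r; apply: norm_conj_mul.
rewrite rmorphM rmorphD fmorphV /= conj_num_e conj_s.
have -> : ((B3 a b c)^*)%R = - 2 * (a ^+ 2 - c ^+ 2) * B1 a b c * A2 a b
    / (a ^+ 8 * b ^+ 7 * c ^+ 4).
  by rewrite /B3 !rmorphM /= conj_A1 conj_A2 /cnorm; conj_tac.
have num_e_sqr :
    num_e a b c ^+ 2 - s ^+ 2 = - 4 * Uabc a b c * Vabc a b c * A2 a b ^+ 2.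
  have := double_U a b c; have := double_V a b c.
  rewrite sC CE_sqr B2E num_eE => dV dU.
  (* Both sides are [(P^2 + Q^2)^2 A3^2 - num_f^2], because [(Q^2 - P^2)^2 + 4 P^2 Q^2 = (P^2 +
     Q^2)^2]. *)
  transitivity (- (2 * Uabc a b c * A2 a b) * (2 * Vabc a b c * A2 a b)).
    by rewrite dV dU; ring.
  by ring.
transitivity ((num_e a b c ^+ 2 - s ^+ 2) / (- 4 * Uabc a b c * Vabc a b c * A2 a b ^+ 2)).
  by rewrite /Uabc /Vabc /B3 /cnorm; field; rewrite ?a0 ?b0 ?c0 ?A10 ?B10 A20 M0 Mm Mp.
rewrite num_e_sqr divff // /Uabc /Vabc.
by do ![exact: B10 | by [] | apply: mulf_neq0 | apply: expf_neq0
        | rewrite oppr_eq0 pnatr_eq0].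
Qed.

End Torus.
End Moduli.

(** * Fourth roots of prescribed sign and the principal square root *)

Section Roots.
Variable R : realType.
Implicit Types a b c d e f z s u : R[i].

Lemma Re_norm z : (complex.Re `|z|)%:C = `|z|.
Proof. by rewrite RRe_real // normr_real. Qed.

Definition msqrt z : R[i] := (Num.sqrt (complex.Re `|z|))%:C.

Lemma msqrt_sqr z : msqrt z ^+ 2 = `|z|.
Proof.
by rewrite -[RHS]Re_norm /msqrt -rmorphXn /= sqr_sqrtr // -ler0c Re_norm.
Qed.

(* The sign of [Re u] when [`|u| = 1] and [Re u != 0]. *)
Definition resgn u : R[i] := (u + u^-1) / `|u + u^-1|.

Lemma resgn_sqr u : `|u| = 1 -> u + u^-1 != 0 -> resgn u ^+ 2 = 1.
Proof.
move=> u1 u0; rewrite expr_div_n normCK rmorphD fmorphV /= (conj_unit u1) invrK.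
by rewrite (addrC u^-1) -expr2 divff // expf_neq0.
Qed.

(** If a fourth root has real part zero, multiplying it by [i] repairs this; negation then adjusts
    the sign. Square roots would not suffice: those of [-1] are both purely imaginary. *)
Lemma root4_resgn z (k : R[i]) : `|z| = 1 -> k ^+ 2 = 1 ->
  exists u, [/\ `|u| = 1, u ^+ 4 = z, u + u^-1 != 0 & resgn u = k].
Proof.
move=> z1 k1.
have [u [u1 uz u0]] : exists u, [/\ `|u| = 1, u ^+ 4 = z & u + u^-1 != 0].
  pose r := sqrtc (sqrtc z).
  have rz : r ^+ 4 = z by rewrite (exprM r 2 2) /r !sqr_sqrtc.
  have r1 : `|r| = 1.
    by apply/eqP; rewrite -(@pexpr_eq1 _ _ 4) // -normrX rz z1.
  have [rr|rr] := eqVneq (r + r^-1) 0; last by exists r.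
  exists (('i)%C * r); split.
  - by rewrite normrM r1 mulr1 normc_def /= expr0n add0r expr1n sqrtr1.
  - by rewrite exprMn rz (exprM _ 2 2) sqr_i sqrrN expr1n mul1r.
  have i0 : ('i)%C != 0 :> R[i] by rewrite eq_complex /= eqxx oner_eq0.
  have iV : (('i)%C : R[i])^-1 = - ('i)%C.
    by apply: (mulfI i0); rewrite divff // mulrN -expr2 sqr_i opprK.
  have rV : r^-1 = - r by apply/eqP; rewrite -addr_eq0 addrC rr.
  rewrite invfM iV rV.
  rewrite mulrNN -mulr2n mulrn_eq0 /= mulf_neq0 //; exact: unit_neq0.
have /eqP : resgn u ^+ 2 = k ^+ 2 by rewrite k1 resgn_sqr.
rewrite eqf_sqr => /orP[]/eqP su.
  by exists u.
exists (- u); split; rewrite ?normrN ?invrN -?opprD ?oppr_eq0 //.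
  by rewrite -uz exprNn -signr_odd expr0 mul1r.
by rewrite /resgn invrN -opprD normrN mulNr -/(resgn u) su opprK.
Qed.

(* A branch of the square root that is visibly smooth off the closed negative
   real half-line, where it agrees with [sqrtc]. *)
Definition rho z : R[i] := msqrt z * (z + `|z|) / `|z + `|z| |.

Lemma Re_sqrtc_ge0 z : 0 <= complex.Re (sqrtc z).
Proof. by case: z => x y; rewrite /sqrtc /= sqrtr_ge0. Qed.

(** With [m = |z|], the square is [m (z + m) / (conj z + m)], and [m (z + m) = z (conj z + m)]. *)
Lemma rho_sqr z : z + `|z| != 0 -> rho z ^+ 2 = z.
Proof.
move=> z0; rewrite /rho expr_div_n exprMn msqrt_sqr.
have -> : `|z + `|z| | ^+ 2 = (z + `|z|) * ((z^*)%R + `|z|).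
  by rewrite normCK rmorphD /= (conj_Creal (normr_real z)).
rewrite expr2 mulrA -mulf_div mulfK // mulrA.
have zz : `|z| * (z + `|z|) = z * ((z^*)%R + `|z|).
  by rewrite !mulrDr -normCK [RHS]addrC [z * _]mulrC -expr2.
rewrite zz mulfK //; apply: contraNneq z0 => zJ.
by rewrite -conjC_eq0 rmorphD /= (conj_Creal (normr_real z)) zJ.
Qed.

Lemma Re_add_norm_gt0 z : z + `|z| != 0 -> 0 < complex.Re (z + `|z|).
Proof.
case: z => x y; rewrite normc_def /= => z0.
have s0 : `|x| <= Num.sqrt (x ^+ 2 + y ^+ 2).
  by rewrite -sqrtr_sqr ler_wsqrtr // lerDl sqr_ge0.
have xs : 0 <= x + Num.sqrt (x ^+ 2 + y ^+ 2).
  by rewrite -lerBlDl sub0r (le_trans _ s0) // -normrN ler_norm.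
rewrite lt_def xs andbT; apply: contra z0 => /eqP xs0.
have sx : Num.sqrt (x ^+ 2 + y ^+ 2) = - x by apply/eqP; rewrite -addr_eq0 addrC xs0.
have := congr1 (fun t => t ^+ 2) sx.
rewrite sqr_sqrtr ?addr_ge0 ?sqr_ge0 // sqrrN => /eqP.
rewrite -subr_eq0 addrAC subrr add0r sqrf_eq0 => /eqP y0.
by rewrite eq_complex /= xs0 y0 addr0 !eqxx.
Qed.

(** Both are square roots of [z]; they cannot be opposite, since [rho z] has positive real part and
    [sqrtc z] a nonnegative one. *)
Lemma sqrtc_rho z : z + `|z| != 0 -> sqrtc z = rho z.
Proof.
move=> z0; have /eqP : sqrtc z ^+ 2 = rho z ^+ 2 by rewrite sqr_sqrtc rho_sqr.
rewrite eqf_sqr => /orP[/eqP //|/eqP sN].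
have zn0 : z != 0 by apply: contraNneq z0 => ->; rewrite normr0 addr0.
have Rrho : 0 < complex.Re (rho z).
  have -> : rho z = (Num.sqrt (complex.Re `|z|) / complex.Re `|z + `|z| |)%:C * (z + `|z|).
    have real_div (p q : R) : (p / q)%:C = p%:C / q%:C by rewrite rmorphM fmorphV.
    by rewrite real_div Re_norm /rho /msqrt mulrAC.
  have norm_gt0 (w : R[i]) : w != 0 -> 0 < complex.Re `|w|.
    by move=> w0; rewrite -ltcR Re_norm normr_gt0.
  have -> (k : R) (w : R[i]) : complex.Re (k%:C * w) = k * complex.Re w.
    by case: w => x y /=; rewrite mul0r subr0.
  by rewrite mulr_gt0 ?divr_gt0 ?sqrtr_gt0 ?norm_gt0 // Re_add_norm_gt0.
have := Re_sqrtc_ge0 z; rewrite sN; case: (rho z) Rrho => x y /= x0.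
by rewrite oppr_ge0 leNgt x0.
Qed.

End Roots.

(** * The continuous parametrization and its image *)

Section Parametrization.
Variable R : realType.
Implicit Types (a b c k z s u : R[i]) (x : 'rV[R[i]]_3).

Definition param_a x := x 0 0 ^+ 4.
Definition param_b x := x 0 1 ^+ 4.
Definition param_c x := x 0 2.

Definition delta u a b c := resgn u * (A1 a b c / (`|A1 a b c| * a * b)).
Definition signed_sqrtC u a b c := resgn u * (('i)%C * cnorm a b c * msqrt (C a b c)).

Definition param_d x := delta (x 0 0) (param_a x) (param_b x) (param_c x).
Definition param_sqrtC x := signed_sqrtC (x 0 1) (param_a x) (param_b x) (param_c x).
Definition param_e x :=
  param_d x * (num_e (param_a x) (param_b x) (param_c x) + param_sqrtC x)
    / B3 (param_a x) (param_b x) (param_c x).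
Definition param_f x :=
  (num_f (param_a x) (param_b x) (param_c x) + param_sqrtC x)
    / B2 (param_a x) (param_b x) (param_c x).

Definition param x :=
  T8C (param_a x) (param_b x) (param_c x) (param_d x) (param_e x) (param_f x).

Definition param_domain : set 'rV[R[i]]_3 :=
  [set x | [/\ @torus R 3 x, x 0 0 + (x 0 0)^-1 != 0, x 0 1 + (x 0 1)^-1 != 0,
     domain_C (param_a x, param_b x, param_c x) &
     d' (param_a x) (param_b x) (param_c x) = param_d x /\
     sqrtc (C (param_a x) (param_b x) (param_c x)) = param_sqrtC x]].

Lemma param_S_C x : param_domain x -> param x = S_C (param_a x, param_b x, param_c x).
Proof. by case=> _ _ _ _ [dE sE]; rewrite /param /param_e /param_f -dE -sE. Qed.

Lemma d'_sqr a b c : B1 a b c != 0 -> d' a b c ^+ 2 * B1 a b c = c * A1 a b c.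
Proof. by move=> B10; rewrite /d' expr_div_n sqrrN !sqr_sqrtc divfK. Qed.

Lemma S_C_hadamard (abc : R[i] * R[i] * R[i]) : domain_C abc -> @hadamard R 8 (S_C abc).
Proof.
case: abc => [[a b] c] [[a1 b1 c1] [C0 B10 B20 B30]].
have dB := d'_sqr B10; have sC := sqr_sqrtc (C a b c).
have [b0 c0] := (unit_neq0 b1, unit_neq0 c1).
apply: T8C_hadamard => //.
- exact: (norm_d a1 b1 c1 dB).
- exact: (norm_e a1 b1 c1 dB sC).
- exact: (norm_f a1 b1 c1 sC).
- by rewrite /gram1 dB subrr.
- exact: (gram2_eq0 dB sC).
- exact: (gram3_eq0 dB sC).
Qed.

Section Signs.
Variables a b c : R[i].
Hypotheses (a1 : `|a| = 1) (b1 : `|b| = 1) (c1 : `|c| = 1).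

Let a0 := unit_neq0 a1.
Let b0 := unit_neq0 b1.
Let c0 := unit_neq0 c1.

(** By [conj_A1], [|A1|^2 = A1 B1 / (a^2 b^2 c)], so the square of [A1 / (|A1| a b)] is
    [c A1 / B1]. *)
Lemma d'_sign u : B1 a b c != 0 -> resgn u ^+ 2 = 1 ->
  d' a b c ^+ 2 = delta u a b c ^+ 2.
Proof.
move=> B10 u2; apply: (mulIf B10); rewrite d'_sqr // /delta exprMn u2 mul1r.
rewrite expr_div_n !exprMn normCK conj_A1 //.
have A10 : A1 a b c != 0 by rewrite -normr_eq0 norm_A1 // normr_eq0.
by field; rewrite a0 b0 c0 A10 B10.
Qed.

Lemma sqrtc_C_sign u : C a b c / (a ^+ 8 * b ^+ 8 * c ^+ 4) <= 0 ->
  resgn u ^+ 2 = 1 -> sqrtc (C a b c) ^+ 2 = signed_sqrtC u a b c ^+ 2.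
Proof.
move=> C0 u2; rewrite sqr_sqrtc /signed_sqrtC exprMn u2 mul1r !exprMn sqr_i msqrt_sqr.
have N1 : `|a ^+ 8 * b ^+ 8 * c ^+ 4| = 1.
  by rewrite !normrM !a1 !b1 !c1 !mulr1.
have -> : `|C a b c| = - (C a b c / (a ^+ 8 * b ^+ 8 * c ^+ 4)).
  by rewrite -ler0_norm // normrM normfV N1 invr1 mulr1.
by rewrite /cnorm; field; rewrite a0 b0 c0.
Qed.

End Signs.

Lemma param_domain_onto a b c : domain_C (a, b, c) ->
  exists x, [/\ param_domain x, param_a x = a, param_b x = b & param_c x = c].
Proof.
move=> Dabc; have [[a1 b1 c1] [C0 B10 B20 B30]] := Dabc.
(* An auxiliary number of sign [1] reduces [delta] and [signed_sqrtC] to their unsigned formulas.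
   The signs [k1], [k2] found by comparison are then imposed on the fourth roots of [a] and [b]. *)
have [w [w1 _ w0 sw]] := root4_resgn (normr1 R[i]) (expr1n _ 2).
have [sd ss] : d' a b c ^+ 2 = delta w a b c ^+ 2 /\
    sqrtc (C a b c) ^+ 2 = signed_sqrtC w a b c ^+ 2.
  by split; [apply: d'_sign|apply: sqrtc_C_sign]; rewrite ?sw ?expr1n.
have [k1 [k1E dE]] : exists k, k ^+ 2 = 1 /\
    d' a b c = k * (A1 a b c / (`|A1 a b c| * a * b)).
  move/eqP: sd; rewrite eqf_sqr /delta sw mul1r => /orP[]/eqP ->.
    by exists 1; rewrite expr1n mul1r.
  by exists (-1); rewrite sqrrN expr1n mulN1r.
have [k2 [k2E sE]] : exists k, k ^+ 2 = 1 /\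
    sqrtc (C a b c) = k * (('i)%C * cnorm a b c * msqrt (C a b c)).
  move/eqP: ss; rewrite eqf_sqr /signed_sqrtC sw mul1r => /orP[]/eqP ->.
    by exists 1; rewrite expr1n mul1r.
  by exists (-1); rewrite sqrrN expr1n mulN1r.
have [u [u1 ua u0 su]] := root4_resgn a1 k1E.
have [v [v1 vb v0 sv]] := root4_resgn b1 k2E.
pose x : 'rV[R[i]]_3 := \row_j nth 0 [:: u; v; c] j.
have [x0 x1 x2] : [/\ x 0 0 = u, x 0 1 = v & x 0 2 = c] by rewrite !mxE.
exists x; rewrite /param_domain /= /param_d /param_sqrtC.
rewrite /param_a /param_b /param_c x0 x1 x2 ua vb.
split=> //; split=> //; last by rewrite /delta /signed_sqrtC su sv.
by move=> j; rewrite mxE; case: j => [[|[|[|//]]] hj].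
Qed.

Lemma param_image : param @` param_domain = @S_C R @` @domain_C R.
Proof.
apply/seteqP; split=> [_ [x Dx <-]|_ [[[a b] c] Dabc <-]].
  by rewrite param_S_C //; exists (param_a x, param_b x, param_c x) => //; case: Dx.
have [x [Dx xa xb xc]] := param_domain_onto Dabc.
by exists x => //; rewrite param_S_C // xa xb xc.
Qed.

End Parametrization.

(** * Closure properties common to continuity and differentiability *)

Section FieldClass.
Variables (R : realType) (T : Type) (t0 : T).

(* Shared by continuity at a point and differentiability at a point. *)
Record field_class (K : (T -> R[i]) -> Prop) : Prop := FieldClass {
  classC : forall k, K (fun=> k);
  classD : forall g h, K g -> K h -> K (fun t => g t + h t);
  classM : forall g h, K g -> K h -> K (fun t => g t * h t);
  classV : forall g, K g -> g t0 != 0 -> K (fun t => (g t)^-1);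
  class_norm : forall g, K g -> g t0 != 0 -> K (fun t => `|g t|) }.

Variable K : (T -> R[i]) -> Prop.
Hypothesis KP : field_class K.

Lemma classN g : K g -> K (fun t => - g t).
Proof.
move=> Kg; have -> : (fun t => - g t) = (fun t => -1 * g t).
  by apply/funext => t; rewrite mulN1r.
by apply: (classM KP) => //; exact: (classC KP).
Qed.

Lemma classX g n : K g -> K (fun t => g t ^+ n).
Proof.
move=> Kg; elim: n => [|n Kn]; first exact: (classC KP).
have -> : (fun t => g t ^+ n.+1) = (fun t => g t * g t ^+ n).
  by apply/funext => t; rewrite exprS.
exact: (classM KP).
Qed.

Ltac class_tac := repeat (first [assumption | exact (classC KP _)
  | refine (classD KP _ _) | refine (classM KP _ _) | refine (classN _) | refine (classX _ _)]).

Section Triple.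
Variables a b c : T -> R[i].
Hypotheses (Ka : K a) (Kb : K b) (Kc : K c).

Lemma class_A1 : K (fun t => A1 (a t) (b t) (c t)).
Proof. rewrite /A1; class_tac. Qed.

Lemma class_A2 : K (fun t => A2 (a t) (b t)).
Proof. rewrite /A2; class_tac. Qed.

Lemma class_A3 : K (fun t => A3 (a t) (b t) (c t)).
Proof. rewrite /A3; class_tac. Qed.

Lemma class_B1 : K (fun t => B1 (a t) (b t) (c t)).
Proof. rewrite /B1; class_tac. Qed.

Lemma class_B2 : K (fun t => B2 (a t) (b t) (c t)).
Proof. have := class_A3; rewrite /B2 => ?; class_tac. Qed.

Lemma class_B3 : K (fun t => B3 (a t) (b t) (c t)).
Proof. have := class_A1; have := class_A2; rewrite /B3 => ? ?; class_tac. Qed.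

Lemma class_num_e : K (fun t => num_e (a t) (b t) (c t)).
Proof. have := class_A3; rewrite /num_e => ?; class_tac. Qed.

Lemma class_num_f : K (fun t => num_f (a t) (b t) (c t)).
Proof. have := class_A2; rewrite /num_f => ?; class_tac. Qed.

Lemma class_C : K (fun t => C (a t) (b t) (c t)).
Proof. have := class_A2; have := class_A3; rewrite /C => ? ?; class_tac. Qed.

Lemma class_resgn g : K g -> g t0 != 0 -> g t0 + (g t0)^-1 != 0 ->
  K (fun t => resgn (g t)).
Proof.
move=> Kg g0 gg0; have Kgg : K (fun t => g t + (g t)^-1).
  by refine (classD KP _ _) => //; exact: (classV KP).
refine (classM KP _ _) => //; apply: (classV KP); last by rewrite normr_eq0.
exact: (class_norm KP).
Qed.

Lemma class_delta g : K g -> g t0 != 0 -> g t0 + (g t0)^-1 != 0 ->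
    a t0 != 0 -> b t0 != 0 -> A1 (a t0) (b t0) (c t0) != 0 ->
  K (fun t => delta (g t) (a t) (b t) (c t)).
Proof.
move=> Kg g0 gg0 a0 b0 A10; have KA := class_A1.
refine (classM KP (class_resgn _ _ _) (classM KP _ _)) => //.
apply: (classV KP); last by rewrite !mulf_neq0 // normr_eq0.
by refine (classM KP (classM KP (class_norm KP _ _) _) _).
Qed.

Lemma class_signed_sqrtC g : K g -> g t0 != 0 -> g t0 + (g t0)^-1 != 0 ->
    K (fun t => msqrt (C (a t) (b t) (c t))) ->
  K (fun t => signed_sqrtC (g t) (a t) (b t) (c t)).
Proof.
move=> Kg g0 gg0 KC; have Ks := class_resgn Kg g0 gg0.
rewrite /signed_sqrtC /cnorm; class_tac.
Qed.

Lemma class_T8C d e f i j : K d -> K e -> K f ->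
  K (fun t => T8C (a t) (b t) (c t) (d t) (e t) (f t) i j).
Proof.
move=> Kd Ke Kf.
rewrite /T8C; under eq_fun do rewrite mxE.
case: i => [[|[|[|[|[|[|[|[|//]]]]]]]] hi];
case: j => [[|[|[|[|[|[|[|[|//]]]]]]]] hj] /=; class_tac.
Qed.

End Triple.

Section Param.
Variable x : T -> 'rV[R[i]]_3.
Hypotheses (Kx : forall j, K (fun t => x t 0 j)) (x0 : forall j, x t0 0 j != 0).
Hypotheses (u0 : x t0 0 0 + (x t0 0 0)^-1 != 0) (v0 : x t0 0 1 + (x t0 0 1)^-1 != 0).
Let a t : R[i] := param_a (x t).
Let b t : R[i] := param_b (x t).
Let c t : R[i] := param_c (x t).
Hypotheses (A10 : A1 (a t0) (b t0) (c t0) != 0).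
Hypotheses (B20 : B2 (a t0) (b t0) (c t0) != 0) (B30 : B3 (a t0) (b t0) (c t0) != 0).
(** Kept as an assumption because [msqrt] is continuous everywhere but not differentiable at [0],
    and the condition in [domain_C] allows [C = 0]. *)
Hypothesis KC : K (fun t => msqrt (C (a t) (b t) (c t))).

Lemma class_param_a : K a. Proof. exact (classX 4 (Kx 0)). Qed.

Lemma class_param_b : K b. Proof. exact (classX 4 (Kx 1)). Qed.

Lemma class_param_c : K c. Proof. exact (Kx 2). Qed.

Lemma class_param_d : K (fun t => param_d (x t)).
Proof.
exact (class_delta class_param_a class_param_b class_param_c (Kx 0) (x0 0) u0
  (expf_neq0 4 (x0 0)) (expf_neq0 4 (x0 1)) A10).
Qed.

Lemma class_param_sqrtC : K (fun t => param_sqrtC (x t)).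
Proof.
exact (class_signed_sqrtC class_param_a class_param_b class_param_c (Kx 1)
  (x0 1) v0 KC).
Qed.

Lemma class_param i j : K (fun t => param (x t) i j).
Proof.
have [Ka Kb Kc] := And3 class_param_a class_param_b class_param_c.
have Ke : K (fun t => param_e (x t)).
  exact (classM KP
    (classM KP class_param_d (classD KP (class_num_e Ka Kb Kc) class_param_sqrtC))
    (classV KP (class_B3 Ka Kb Kc) B30)).
have Kf : K (fun t => param_f (x t)).
  exact (classM KP (classD KP (class_num_f Ka Kb Kc) class_param_sqrtC)
    (classV KP (class_B2 Ka Kb Kc) B20)).
exact (class_T8C Ka Kb Kc i j class_param_d Ke Kf).
Qed.
End Param.
End FieldClass.

(** * Continuity of the parametrization *)

Section Continuity.
Variable R : realType.

Lemma continuous_class (T : topologicalType) (x : T) :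
  field_class x (fun g : T -> R[i] => {for x, continuous g}).
Proof.
split.
- by move=> k; exact: cst_continuous.
- by move=> g h cg ch; exact: (cvgD cg ch).
- by move=> g h cg ch; exact: (cvgM cg ch).
- by move=> g cg g0; exact: (cvgV g0 cg).
- by move=> g cg _; exact: (cvg_norm cg).
Qed.

Lemma continuous_Re : continuous (@complex.Re R : R[i] -> R).
Proof.
move=> z A [e /= e0 eA]; exists e%:C; first by rewrite /= ltcR.
move=> w /= zw; apply: eA; rewrite /= -ltcR; apply: le_lt_trans zw.
by rewrite -raddfB normc_ge_Re.
Qed.

Lemma continuous_real_complex : continuous (real_complex R : R -> R[i]).
Proof.
move=> x A [e /= e0 eA].
(* Radii of balls in [R[i]] are themselves elements of [R[i]]; a positive one is real. *)
have eR : (complex.Re e)%:C = e by rewrite RRe_real // gtr0_real.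
exists (complex.Re e); first by rewrite /= -ltcR eR.
move=> y /= xy; apply: eA.
by rewrite /= -rmorphB -eR normc_def /= expr0n addr0 sqrtr_sqr ltcR.
Qed.

Lemma continuous_msqrt : continuous (@msqrt R).
Proof.
move=> z; apply: continuous_comp; last exact: continuous_real_complex.
apply: continuous_comp; last exact: sqrt_continuous.
apply: continuous_comp; last exact: continuous_Re.
exact: norm_continuous.
Qed.

Lemma continuous_mxP (T : topologicalType) m n (f : T -> 'M[R[i]]_(m, n)) x :
  (forall i j, {for x, continuous (fun t => f t i j)}) -> {for x, continuous f}.
Proof.
move=> fij A [P /= fP PA].
apply: filterS (_ : nbhs x [set t | forall i j, P i j (f t i j)]) => [t tP|].
  exact: PA.
apply: filter_forall => i; apply: filter_forall => j.
exact: fij (fP i j).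
Qed.

Lemma param_continuous : {within @param_domain R, continuous (@param R)}.
Proof.
apply: continuous_in_subspaceT => x; rewrite inE => -[tx u0 v0 Dx _].
have [[a1 b1 c1] [_ B10 B20 B30]] := Dx.
have KP := continuous_class x.
have Kx j : {for x, continuous (fun t : 'rV[R[i]]_3 => t 0 j)} by exact: coord_continuous.
have [_ A10 _] := B3_neq0E B30.
have x0 j : x 0 j != 0 by exact: unit_neq0.
apply: continuous_mxP => i j.
apply: (class_param KP (x := id) Kx x0 u0 v0 A10 B20 B30).
apply: continuous_comp; last exact: continuous_msqrt.
exact (class_C KP (class_param_a KP Kx) (class_param_b KP Kx) (class_param_c Kx)).
Qed.
End Continuity.

(** * Real differentiability of complex-valued maps *)

Section Differentiability.
Variables (R : realType) (V : normedModType R) (t0 : V).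
Implicit Types (g h : V -> R[i]) (p q : V -> R).

(** Differentiability over the reals, componentwise, since moduli are not holomorphic. *)
Definition cdiff g :=
  differentiable (fun t => complex.Re (g t)) t0 /\
  differentiable (fun t => complex.Im (g t)) t0.

Lemma differentiable_sqrt p : differentiable p t0 -> 0 < p t0 ->
  differentiable (fun t => Num.sqrt (p t)) t0.
Proof.
move=> dp p0; apply: (differentiable_comp dp).
by apply/derivable1_diffP; case: (is_derive1_sqrt p0).
Qed.

Lemma Re2Im2_gt0 (z : R[i]) : z != 0 -> 0 < complex.Re z ^+ 2 + complex.Im z ^+ 2.
Proof. by move=> z0; rewrite -ltcR add_Re2_Im2 exprn_gt0 // normr_gt0. Qed.

Lemma differentiable_Re2Im2 g : cdiff g ->
  differentiable (fun t => complex.Re (g t) ^+ 2 + complex.Im (g t) ^+ 2) t0.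
Proof. by move=> [gr gi]; apply: differentiableD; exact: differentiableM. Qed.

Lemma cdiff_norm g : cdiff g -> g t0 != 0 ->
  differentiable (fun t => complex.Re `|g t|) t0.
Proof.
move=> dg g0; under eq_fun do rewrite normc_def /=.
by apply: differentiable_sqrt; [exact: differentiable_Re2Im2|exact: Re2Im2_gt0].
Qed.

Lemma cdiff_class : field_class t0 cdiff.
Proof.
split.
- by move=> k; split; exact: differentiable_cst.
- move=> g h [gr gi] [hr hi]; split.
    by under eq_fun do rewrite raddfD; exact: differentiableD.
  by under eq_fun do rewrite raddfD; exact: differentiableD.
- move=> g h [gr gi] [hr hi]; split.
    have -> : (fun t => complex.Re (g t * h t)) =
        (fun t => complex.Re (g t)) * (fun t => complex.Re (h t)) -
        (fun t => complex.Im (g t)) * (fun t => complex.Im (h t)).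
      by apply/funext => t; rewrite !fctE; case: (g t) (h t) => ? ? [].
    by apply: differentiableB; exact: differentiableM.
  have -> : (fun t => complex.Im (g t * h t)) =
      (fun t => complex.Re (g t)) * (fun t => complex.Im (h t)) +
      (fun t => complex.Im (g t)) * (fun t => complex.Re (h t)).
    by apply/funext => t; rewrite !fctE; case: (g t) (h t) => ? ? [].
  by apply: differentiableD; exact: differentiableM.
- move=> g dg g0; have [gr gi] := dg.
  pose n t := complex.Re (g t) ^+ 2 + complex.Im (g t) ^+ 2.
  have dn : differentiable (fun t => (n t)^-1) t0.
    apply: differentiableV; last by rewrite gt_eqF // Re2Im2_gt0.
    exact: differentiable_Re2Im2.
  split.
    have -> : (fun t => complex.Re (g t)^-1) =
        (fun t => complex.Re (g t)) * (fun t => (n t)^-1).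
      by apply/funext => t; rewrite !fctE /n; case: (g t).
    exact: differentiableM.
  have -> : (fun t => complex.Im (g t)^-1) =
      - ((fun t => complex.Im (g t)) * (fun t => (n t)^-1)).
    by apply/funext => t; rewrite !fctE /n; case: (g t) => x y.
  by apply: differentiableN; exact: differentiableM.
- move=> g dg g0; split; first exact: cdiff_norm.
  by under eq_fun do rewrite normc_def /=; exact: differentiable_cst.
Qed.

Lemma cdiff_msqrt g : cdiff g -> g t0 != 0 -> cdiff (fun t => msqrt (g t)).
Proof.
move=> dg g0; split; last exact: differentiable_cst.
apply: differentiable_sqrt; first exact: cdiff_norm.
by rewrite -ltcR Re_norm normr_gt0.
Qed.

Lemma cdiff_rho g : cdiff g -> g t0 + `|g t0| != 0 -> cdiff (fun t => rho (g t)).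
Proof.
move=> dg gg0; have KP := cdiff_class.
have g0 : g t0 != 0 by apply: contraNneq gg0 => ->; rewrite normr0 addr0.
have dgg : cdiff (fun t => g t + `|g t|) := classD KP dg (class_norm KP dg g0).
have n0 : `|g t0 + `|g t0| | != 0 by rewrite normr_eq0.
exact (classM KP (classM KP (cdiff_msqrt dg g0) dgg)
  (classV KP (class_norm KP dgg gg0) n0)).
Qed.

Lemma cdiff_neq0_near g : cdiff g -> g t0 != 0 -> \forall t \near t0, g t != 0.
Proof.
have near0 p : differentiable p t0 -> p t0 != 0 -> \forall t \near t0, p t != 0.
  by move=> /differentiable_continuous; exact: cvgr_neq0.
move=> [gr gi]; rewrite eq_complex negb_and => /orP[] g0.
  by apply: filterS (near0 _ gr g0) => t; rewrite eq_complex negb_and => ->.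
by apply: filterS (near0 _ gi g0) => t; rewrite eq_complex negb_and orbC => ->.
Qed.

End Differentiability.

(** * Angle coordinates and interior points of the domain *)

Section Angles.
Variable R : realType.
Implicit Types (theta : 'rV[R]_3) (a b c z : R[i]).

Lemma norm_expi (t : R) : `|expi t| = 1.
Proof. by rewrite normc_def /= cos2Dsin2 sqrtr1. Qed.

Lemma expi_onto z : `|z| = 1 -> exists t : R, expi t = z.
Proof.
case: z => x y; rewrite normc_def => /(congr1 (@complex.Re R)) /= xy1.
have xy : x ^+ 2 + y ^+ 2 = 1.
  by rewrite -(sqr_sqrtr (addr_ge0 (sqr_ge0 x) (sqr_ge0 y))) xy1 expr1n.
have x1 : -1 <= x <= 1.
  rewrite -ler_norml -(@ler_pXn2r _ 2) ?nnegrE // expr1n.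
  by rewrite real_normK ?num_real // -xy lerDl sqr_ge0.
have yE : `|y| = sin (acos x).
  by rewrite sin_acos // -sqrtr_sqr -xy addrAC subrr add0r.
have [y0|y0] := leP 0 y.
  by exists (acos x); rewrite /expi acosK // -yE ger0_norm.
by exists (- acos x); rewrite /expi cosN sinN acosK // -yE ltr0_norm // opprK.
Qed.

Lemma torus_of_angles_onto n (x : 'rV[R[i]]_n) : torus x ->
  exists theta : 'rV[R]_n, torus_of_angles theta = x.
Proof.
move=> tx; have /boolp.choice [t tE] j : exists t : R, expi t = x 0 j.
  exact: expi_onto.
by exists (\row_j t j); apply/rowP => j; rewrite !mxE tE.
Qed.

Lemma torus_torus_of_angles n (theta : 'rV[R]_n) : torus (torus_of_angles theta).
Proof. by move=> j; rewrite mxE norm_expi. Qed.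

Lemma cdiff_torus_of_angles theta j :
  cdiff theta (fun t : 'rV[R]_3 => torus_of_angles t 0 j).
Proof.
rewrite /cdiff; split; under eq_fun do rewrite mxE /=.
  apply: (@differentiable_comp _ _ _ _ (fun t : 'rV[R]_3 => t 0 j) cos).
    exact: differentiable_coord.
  by apply/derivable1_diffP; exact: derivable_cos.
apply: (@differentiable_comp _ _ _ _ (fun t : 'rV[R]_3 => t 0 j) sin).
  exact: differentiable_coord.
by apply/derivable1_diffP; exact: derivable_sin.
Qed.

Section Near.
Variable theta : 'rV[R]_3.
Let x (t : 'rV[R]_3) := torus_of_angles t.
Let a t := param_a (x t).
Let b t := param_b (x t).
Let c t := param_c (x t).
Hypothesis Dx : param_domain (x theta).
Hypothesis C_lt0 :
  C (a theta) (b theta) (c theta) / (a theta ^+ 8 * b theta ^+ 8 * c theta ^+ 4) < 0.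
Let D_ (z : R[i]) := z + `|z| != 0.
Hypotheses (DA1 : D_ (c theta * A1 (a theta) (b theta) (c theta)))
  (DB1 : D_ (B1 (a theta) (b theta) (c theta)))
  (DC : D_ (C (a theta) (b theta) (c theta))).

Let KP := cdiff_class theta.
Let Kx := cdiff_torus_of_angles theta.
Let Ka : cdiff theta a := class_param_a KP Kx.
Let Kb : cdiff theta b := class_param_b KP Kx.
Let Kc : cdiff theta c := class_param_c Kx.
Let x0 t j : x t 0 j != 0.
Proof. by apply: unit_neq0; exact: torus_torus_of_angles. Qed.
Let C0 : C (a theta) (b theta) (c theta) != 0.
Proof. by apply: contraTneq C_lt0 => ->; rewrite mul0r ltxx. Qed.
Let KC : cdiff theta (fun t => msqrt (C (a t) (b t) (c t))).
Proof. exact (cdiff_msqrt (class_C KP Ka Kb Kc) C0). Qed.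
Let norm_a t : `|a t| = 1.
Proof. by rewrite /a /param_a normrX torus_torus_of_angles expr1n. Qed.
Let norm_b t : `|b t| = 1.
Proof. by rewrite /b /param_b normrX torus_torus_of_angles expr1n. Qed.
Let norm_c t : `|c t| = 1.
Proof. exact: torus_torus_of_angles. Qed.

Lemma cdiff_param i j : cdiff theta (fun t => param (x t) i j).
Proof.
have [_ u0 v0 [_ [_ _ B20 B30]] _] := Dx; have [_ A10 _] := B3_neq0E B30.
exact (class_param KP Kx (x0 theta) u0 v0 A10 B20 B30 KC i j).
Qed.

Let near_C : \forall t \near theta,
  C (a t) (b t) (c t) / (a t ^+ 8 * b t ^+ 8 * c t ^+ 4) <= 0.
Proof.
pose q t := C (a t) (b t) (c t) / (a t ^+ 8 * b t ^+ 8 * c t ^+ 4).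
(* The quotient is real at every angle, so its strict negativity at [theta] persists nearby by
   continuity of its real part. *)
have q_real t : (complex.Re (q t))%:C = q t.
  rewrite RRe_real //; apply/CrealP; rewrite /q.
  have -> : a t ^+ 8 * b t ^+ 8 * c t ^+ 4 = cnorm (a t) (b t) (c t) ^+ 2.
    by rewrite /cnorm; ring.
  exact: conj_C.
have a0 t : a t != 0 by exact: unit_neq0.
have b0 t : b t != 0 by exact: unit_neq0.
have c0 t : c t != 0 by exact: unit_neq0.
have Kq : cdiff theta q.
  have K1 := classM KP (classM KP (classX KP 8 Ka) (classX KP 8 Kb)) (classX KP 4 Kc).
  apply: (classM KP (class_C KP Ka Kb Kc) (classV KP K1 _)).
  by rewrite !mulf_neq0 ?expf_neq0.
have [/differentiable_continuous cq _] := Kq.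
have q0 : complex.Re (q theta) < 0 by rewrite -ltcR q_real.
apply: filterS (cvgr_lt _ cq _ q0) => t qt.
by rewrite -/(q t) -q_real lecR ltW.
Qed.

Let rho_neq0 z : D_ z -> rho z != 0.
Proof.
move=> Dz; apply/eqP => rz; move: (rho_sqr Dz) (Dz).
by rewrite rz expr0n /= => <-; rewrite /D_ normr0 addr0 eqxx.
Qed.

(** Near [theta], [d'] equals [param_d] up to sign. At [theta] they agree, so their sum is
    [2 d' != 0]; written with [rho] it is continuous and stays nonzero, which excludes the wrong
    sign. The same argument applies to the root of [C]. *)
Lemma param_domain_near : \forall t \near theta, param_domain (x t).
Proof.
have [_ u0 v0 [_ [_ B10 B20 B30]] [dE sE]] := Dx.
have [_ A10 _] := B3_neq0E B30.
have KcA := classM KP Kc (class_A1 KP Ka Kb Kc).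
have KB := class_B1 KP Ka Kb Kc; have KCC := class_C KP Ka Kb Kc.
have Kd := class_param_d KP Kx (x0 theta) u0 A10.
have Ks := class_param_sqrtC KP Kx (x0 theta) v0 KC.
have [rA rB] := (rho_neq0 DA1, rho_neq0 DB1).
have Dnear g : cdiff theta g -> D_ (g theta) -> \forall t \near theta, D_ (g t).
  move=> Kg Dg; have g0 : g theta != 0.
    by apply: contraNneq Dg => ->; rewrite normr0 addr0.
  exact (cdiff_neq0_near (classD KP Kg (class_norm KP Kg g0)) Dg).
have sqr2 z : z != 0 -> z + z != 0 by rewrite -mulr2n mulrn_eq0.
have d_near : \forall t \near theta,
    - rho (c t * A1 (a t) (b t) (c t)) / rho (B1 (a t) (b t) (c t)) + param_d (x t) != 0.
  have Kq := classD KP (classM KP (classN KP (cdiff_rho KcA DA1))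
    (classV KP (cdiff_rho KB DB1) rB)) Kd.
  apply: (cdiff_neq0_near Kq); rewrite -!sqrtc_rho // -dE; apply: sqr2.
  by rewrite /d' mulf_neq0 ?oppr_eq0 ?invr_eq0 // sqrtc_rho.
have s_near : \forall t \near theta, rho (C (a t) (b t) (c t)) + param_sqrtC (x t) != 0.
  apply: (cdiff_neq0_near (classD KP (cdiff_rho KCC DC) Ks)); rewrite -sqrtc_rho // -sE.
  by apply: sqr2; rewrite sqrtc_rho // rho_neq0.
have u_near := cdiff_neq0_near (classD KP (Kx 0) (classV KP (Kx 0) (x0 theta 0))) u0.
have v_near := cdiff_neq0_near (classD KP (Kx 1) (classV KP (Kx 1) (x0 theta 1))) v0.
near=> t.
have [u1 v1] : x t 0 0 + (x t 0 0)^-1 != 0 /\ x t 0 1 + (x t 0 1)^-1 != 0.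
  by split; near: t.
have B1t : B1 (a t) (b t) (c t) != 0 by near: t; exact (cdiff_neq0_near KB B10).
have Ct : C (a t) (b t) (c t) / (a t ^+ 8 * b t ^+ 8 * c t ^+ 4) <= 0 by near: t.
have tx := torus_torus_of_angles t.
split=> //.
  split; first by split; [exact: norm_a|exact: norm_b|exact: norm_c].
  split=> //; near: t.
    exact (cdiff_neq0_near (class_B2 KP Ka Kb Kc) B20).
  exact (cdiff_neq0_near (class_B3 KP Ka Kb Kc) B30).
split.
  have := d'_sign (norm_a t) (norm_b t) (norm_c t) B1t (resgn_sqr (tx 0) u1).
  move/eqP; rewrite eqf_sqr => /orP[/eqP //|]; rewrite -addr_eq0 /d' !sqrtc_rho.
  - by rewrite (negPf (near d_near t _)).
  - by near: t; exact: Dnear KB DB1.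
  - by near: t; exact: Dnear KcA DA1.
have := sqrtc_C_sign (norm_a t) (norm_b t) (norm_c t) Ct (resgn_sqr (tx 1) v1).
move/eqP; rewrite eqf_sqr => /orP[/eqP //|]; rewrite -addr_eq0 sqrtc_rho.
- by rewrite (negPf (near s_near t _)).
- by near: t; exact: Dnear KCC DC.
Unshelve. all: by end_near. Qed.

End Near.
End Angles.

(** * A point of the domain off all the branch cuts *)

Section Point.
Variable R : realType.

Lemma complex_mulE (x y u v : R) :
  (x +i* y) * (u +i* v) = (x * u - y * v) +i* (x * v + y * u).
Proof. by []. Qed.

Lemma Im_neq0_addnorm (z : R[i]) : complex.Im z != 0 -> z + `|z| != 0.
Proof.
move=> z0; rewrite addr_eq0; apply: contraNneq z0 => ->.
by rewrite normc_def /= oppr0.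
Qed.

Lemma Im_neq0 (z : R[i]) : complex.Im z != 0 -> z != 0.
Proof. by apply: contraNneq => ->. Qed.

(** The triple 3, 4, 5 gives a unit number with rational coordinates, so all values at the point can
    be computed exactly; [alpha] is its square. *)
Let a : R[i] := (3 / 5) +i* (4 / 5).
Let b : R[i] := ('i)%C.
Let alpha : R[i] := (- 7 / 25) +i* (24 / 25).

Let a2 : a ^+ 2 = alpha.
Proof. by rewrite expr2 complex_mulE; congr (_ +i* _); field. Qed.
Let b2 : b ^+ 2 = -1. Proof. exact: sqr_i. Qed.
Let b4 : b ^+ 4 = 1. Proof. by rewrite (exprM b 2 2) b2 sqrrN expr1n. Qed.
Let a4 : a ^+ 4 = alpha ^+ 2. Proof. by rewrite (exprM a 2 2) a2. Qed.

Let A1E : A1 a b 1 = (- 4 / 25) +i* (- 72 / 25).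
Proof.
transitivity (- 3 * alpha - 1); first by rewrite /A1 a2 b2; ring.
by rewrite /alpha; apply/eqP; rewrite eq_complex /=; apply/andP; split; apply/eqP; field.
Qed.

Let B1E : B1 a b 1 = (68 / 25) +i* (24 / 25).
Proof.
transitivity (alpha + 3); first by rewrite /B1 a2 b2; ring.
by rewrite /alpha; apply/eqP; rewrite eq_complex /=; apply/andP; split; apply/eqP; field.
Qed.

Let A2E : A2 a b = (136 / 25)%:C * alpha.
Proof.
transitivity (alpha ^+ 2 + 6 * alpha + 1); first by rewrite /A2 a2 b2 a4 b4; ring.
by rewrite /alpha; apply/eqP; rewrite eq_complex /=; apply/andP; split; apply/eqP; field.
Qed.

Let A3E : A3 a b 1 = - 2 * A2 a b.
Proof. by rewrite /A3 /A2 !a2 !b2 !a4 !b4; ring. Qed.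

Let alpha0 : alpha != 0.
Proof. by rewrite eq_complex /= negb_and orbC mulf_neq0 ?invr_eq0 ?pnatr_eq0. Qed.

Let A20 : A2 a b != 0.
Proof. by rewrite A2E mulf_neq0 // eq_complex /= eqxx andbT mulf_neq0 ?invr_eq0 ?pnatr_eq0. Qed.

Let CE : C a b 1 = (- 16 * (6528 / 625) ^+ 2)%:C * alpha ^+ 4.
Proof.
transitivity (16 * (alpha ^+ 2 - 1) ^+ 2 * A2 a b ^+ 2).
  by rewrite /C A3E a2 b2; ring.
(* As [alpha] is a unit number, [alpha - 1 / alpha] is [2 i] times its imaginary part [24 / 25]. *)
have -> : alpha ^+ 2 - 1 = (0 +i* (48 / 25)) * alpha.
  by rewrite /alpha; apply/eqP; rewrite eq_complex /=; apply/andP; split; apply/eqP; field.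
have i2 : (0 +i* (48 / 25 : R)) ^+ 2 = (- (48 / 25) ^+ 2)%:C.
  by apply/eqP; rewrite eq_complex /=; apply/andP; split; apply/eqP; field.
have k16 : (- 16 * (6528 / 625 : R) ^+ 2)%:C =
    16 * (- (48 / 25) ^+ 2)%:C * (136 / 25)%:C ^+ 2.
  by apply/eqP; rewrite eq_complex /=; apply/andP; split; apply/eqP; field.
by rewrite A2E exprMn i2 k16; ring.
Qed.

(* At [a = (3 + 4i)/5], [b = i], [c = 1], one has [A3 = - 2 A2] and
   [C = 16 (a^4 - 1)^2 A2^2]. *)
Lemma exists_generic_point : exists abc : R[i] * R[i] * R[i],
  let: (a, b, c) := abc in
  [/\ domain_C (a, b, c), C a b c / (a ^+ 8 * b ^+ 8 * c ^+ 4) < 0,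
   c * A1 a b c + `|c * A1 a b c| != 0, B1 a b c + `|B1 a b c| != 0 &
   C a b c + `|C a b c| != 0].
Proof.
exists (a, b, 1).
have A1i : complex.Im (A1 a b 1) != 0 by rewrite A1E /=; apply/eqP => ?; lra.
have B1i : complex.Im (B1 a b 1) != 0 by rewrite B1E /=; apply/eqP => ?; lra.
have ab0 : a ^+ 2 - b ^+ 2 != 0.
  by rewrite a2 b2; apply: Im_neq0; rewrite /=; apply/eqP => ?; lra.
have a10 : a ^+ 2 - 1 ^+ 2 != 0.
  by rewrite a2 expr1n; apply: Im_neq0; rewrite /=; apply/eqP => ?; lra.
have a0 : a != 0 by apply: Im_neq0; rewrite /=; apply/eqP => ?; lra.
have b0 : b != 0 by apply: Im_neq0; rewrite /= oner_eq0.
have q0 : 1 - b ^+ 2 != 0 by rewrite b2 opprK (pnatr_eq0 _ 2).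
have m20 : (- 2 : R[i]) != 0 by rewrite oppr_eq0.
have two0 : (2 : R[i]) != 0 by [].
have Ci : complex.Im (C a b 1) != 0.
  rewrite CE.
  have -> : alpha ^+ 4 = ((- 527 / 625) +i* (- 336 / 625)) ^+ 2.
    rewrite (exprM _ 2 2); congr (_ ^+ 2).
    by rewrite /alpha; apply/eqP; rewrite eq_complex /=; apply/andP; split; apply/eqP; field.
  rewrite expr2 complex_mulE /=; apply/eqP => ?; lra.
have C_lt0 : C a b 1 / (a ^+ 8 * b ^+ 8 * 1 ^+ 4) < 0.
  have -> : a ^+ 8 * b ^+ 8 * 1 ^+ 4 = alpha ^+ 4.
    by rewrite (exprM a 2 4) (exprM b 4 2) a2 b4 !expr1n !mulr1.
  rewrite CE mulfK ?expf_neq0 // ltcR; lra.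
split.
- split; first split.
  + rewrite normc_def /=; congr (_%:C).
    by rewrite -[RHS](sqrtr1 R); congr Num.sqrt; field.
  + by rewrite normc_def /= expr0n add0r expr1n sqrtr1.
  + by rewrite normr1.
  split; [exact: ltW|exact: Im_neq0| |].
  + rewrite B2E A3E /Pab /Qab.
    exact (mulf_neq0 (mulf_neq0 (mulf_neq0 two0 ab0) (mulf_neq0 a0 q0))
      (mulf_neq0 m20 A20)).
  + have -> : B3 a b 1 = 2 * b * (a ^+ 2 - 1 ^+ 2) * A1 a b 1 * A2 a b.
      by rewrite /B3; ring.
    exact (mulf_neq0 (mulf_neq0 (mulf_neq0 (mulf_neq0 two0 b0) a10) (Im_neq0 A1i)) A20).
- exact: C_lt0.
- by rewrite mul1r Im_neq0_addnorm.
- exact: Im_neq0_addnorm.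
- exact: Im_neq0_addnorm.
Qed.

End Point.

(** * The rank of the Jacobian *)

Section Jacobian.
Variable R : realType.

Lemma expiD (s t : R) : expi (s + t) = expi s * expi t.
Proof. by rewrite /expi cosD sinD; congr (_ +i* _); rewrite addrC [cos _ * _]mulrC. Qed.

Lemma expiX (t : R) n : expi t ^+ n = expi (n%:R * t).
Proof.
elim: n => [|n IH]; first by rewrite mul0r /expi cos0 sin0.
by rewrite exprS IH -expiD -[n.+1]add1n natrD mulrDl mul1r.
Qed.

Lemma realify_l n (M : 'M[R[i]]_n) i j :
  realify M 0 (lshift (n * n) (mxvec_index i j)) = complex.Re (M i j).
Proof. by rewrite /realify row_mxEl mxvecE mxE. Qed.

Lemma realify_r n (M : 'M[R[i]]_n) i j :
  realify M 0 (rshift (n * n) (mxvec_index i j)) = complex.Im (M i j).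
Proof. by rewrite /realify row_mxEr mxvecE mxE. Qed.

Lemma differentiable_rV (V : normedModType R) n (F : V -> 'rV[R]_n) t0 :
  (forall k, differentiable (fun t => F t 0 k) t0) -> differentiable F t0.
Proof.
move=> dF; have -> : F = \sum_(k < n) (fun t => F t 0 k *: delta_mx 0 k).
  by apply/funext => t; rewrite fct_sumE -row_sum_delta.
by apply: differentiable_sum => k; exact: differentiableZl.
Qed.

Section Map.
Variables (k n : nat) (f : 'rV[R[i]]_k -> 'M[R[i]]_n) (theta : 'rV[R]_k).

Lemma differentiable_in_angles :
  (forall i j, cdiff theta (fun t => f (torus_of_angles t) i j)) ->
  differentiable (in_angles f) theta.
Proof.
move=> df; apply: differentiable_rV => l; rewrite /in_angles.
case: (split_ordP l) => {}l ->; case/mxvec_indexP: l => i j.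
  by under eq_fun do rewrite realify_l; case: (df i j).
by under eq_fun do rewrite realify_r; case: (df i j).
Qed.

Lemma derive_line (g : 'rV[R]_k -> R) v :
  'D_v g theta = 'D_1 (fun h : R => g (h *: v + theta)) 0.
Proof.
rewrite /derive; set gram1 := fun h => h^-1 *: _; set gram2 := fun h => h^-1 *: _.
suff -> : gram1 = gram2 by [].
by rewrite funeqE /gram1 /gram2 => h /=; rewrite addr0 scale0r add0r [_%:A]mulr1.
Qed.

(* Where an entry of [f] has the form [expi (l t)], a direction killed by the
   Jacobian is killed by [l], as [cos] and [sin] have no common zero. *)
Lemma jacobian_ker (l : 'rV[R]_k -> R) i j v :
  (forall h v t, l (h *: v + t) = h * l v + l t) ->
  (forall t, f (torus_of_angles t) i j = expi (l t)) ->
  differentiable (in_angles f) theta ->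
  v *m 'J (in_angles f) theta = 0 -> l v = 0.
Proof.
move=> lin fE dF; rewrite -deriveEjacobian // derive_mx; last exact: diff_derivable.
move=> /rowP D0.
have daff : is_derive (0 : R) 1 (fun h => h * l v + l theta) (l v).
  by apply: is_derive_eq; rewrite scaler0 add0r addr0 [_%:A]mulr1.
have aff0 : 0 * l v + l theta = l theta by rewrite mul0r add0r.
have dcos : sin (l theta) * l v = 0.
  have := D0 (lshift (n * n) (mxvec_index i j)); rewrite !mxE /in_angles.
  under eq_fun do rewrite realify_l fE /=.
  rewrite derive_line; under eq_fun do rewrite lin.
  have dc := is_derive_cos (0 * l v + l theta).
  pose g (h : R) := h * l v + l theta.
  rewrite (derive_val (is_derive := @is_derive1_comp _ cos g _ _ _ dc daff)) aff0 mulNr.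
  by move/eqP; rewrite oppr_eq0 => /eqP.
have dsin : cos (l theta) * l v = 0.
  have := D0 (rshift (n * n) (mxvec_index i j)); rewrite !mxE /in_angles.
  under eq_fun do rewrite realify_r fE /=.
  rewrite derive_line; under eq_fun do rewrite lin.
  have ds := is_derive_sin (0 * l v + l theta).
  pose g (h : R) := h * l v + l theta.
  by rewrite (derive_val (is_derive := @is_derive1_comp _ sin g _ _ _ ds daff)) aff0.
rewrite -[LHS]mul1r -(cos2Dsin2 (l theta)) mulrDl !expr2 -!mulrA dcos dsin.
by rewrite !mulr0 addr0.
Qed.

End Map.

(** In the angles, [a], [a b] and [a c] have arguments [4 t0], [4 t0 + 4 t1] and [4 t0 + t2]. These
    linear forms are independent and kill every row vector killed by the Jacobian. *)
Lemma param_rank (theta : 'rV[R]_3) : differentiable (in_angles (@param R)) theta ->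
  \rank ('J (in_angles (@param R)) theta) = 3.
Proof.
move=> dF; apply/eqP; rewrite -/(row_free _); apply: inj_row_free => v vJ.
have v0 : 4 * v 0 0 = 0.
  refine (jacobian_ker (l := fun t => 4 * t 0 0) (i := 0) (j := 0)
    _ _ dF vJ) => [h u t|t].
    by rewrite !mxE; ring.
  by rewrite -expiX /param /T8C mxE /= /param_a mxE.
have v1 : 4 * v 0 0 + 4 * v 0 1 = 0.
  refine (jacobian_ker (l := fun t => 4 * t 0 0 + 4 * t 0 1) (i := 0) (j := 3)
    _ _ dF vJ) => [h u t|t].
    by rewrite !mxE; ring.
  by rewrite expiD -?expiX /param /T8C mxE /= /param_a /param_b /param_c !mxE.
have v2 : 4 * v 0 0 + v 0 2 = 0.
  refine (jacobian_ker (l := fun t => 4 * t 0 0 + t 0 2) (i := 0) (j := 6)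
    _ _ dF vJ) => [h u t|t].
    by rewrite !mxE; ring.
  by rewrite expiD -?expiX /param /T8C mxE /= /param_a /param_b /param_c !mxE.
have [e0 e1 e2] : [/\ v 0 0 = 0, v 0 1 = 0 & v 0 2 = 0] by split; lra.
apply/rowP => -[[|[|[|//]]] hj]; rewrite mxE.
- by rewrite -e0; congr (v _ _); exact: val_inj.
- by rewrite -e1; congr (v _ _); exact: val_inj.
- by rewrite -e2; congr (v _ _); exact: val_inj.
Qed.

End Jacobian.

Theorem theorem4p2 (R : realType) :
  parametric_family 3 (@S_C R @` @domain_C R).
Proof.
(* A preimage of this point, in angles, serves as the interior point: strict negativity of [C] and
   radicands off the cuts make the domain a neighbourhood of it. *)
have [[[a b] c] [Dabc C_lt0 DA DB DC]] := exists_generic_point R.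
have [x [Dx xa xb xc]] := param_domain_onto Dabc.
have [tx _ _ _ _] := Dx.
have [theta thetaE] := torus_of_angles_onto tx.
move: Dx xa xb xc; rewrite -thetaE => Dx xa xb xc.
rewrite -xa -xb -xc in C_lt0 DA DB DC.
have dF : differentiable (in_angles (@param R)) theta.
  by apply: differentiable_in_angles => i j; exact: cdiff_param.
exists (@param_domain R), (@param R); split.
- by move=> y [].
- by move=> _ [y Dy <-]; rewrite param_S_C //; apply: S_C_hadamard; case: Dy.
- exact: param_continuous.
- exists theta; split=> //; last exact: param_rank.
  exact: param_domain_near.
- by rewrite param_image.
Qed.
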